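(* Let $k\ge 1$ be an integer and consider the two partitions $$\mu=(\underbrace{k+1,\dots,k+1}_{k},\,k-1)\quad\text{and}\quad \lambda=(\underbrace{k+1,\dots,k+1}_{k-1},\,k,\,k).$$ Then $\mu$ and $\lambda$ are distinct partitions of $k^2+2k-1$ which cannot be differentiated by their sets of $k$-deletions; that is, the set of $k$-deletions of $\mu$ equals the set of $k$-deletions of $\lambda$.
   Context: A partition of $n$, $\lambda=(\lambda_1,\dots,\lambda_\ell)$, is a finite nonincreasing sequence of positive integers whose sum, denoted $|\lambda|$, is $n$; set $\lambda_i=0$ for $i>\ell$, and trailing zeros are ignored (so for $k=1$ the last part $k-1=0$ of $\mu$ is dropped). A partition is identified with its Ferrers diagram, consisting of left-justified rows where row $i$ has $\lambda_i$ cells. Write $\mu\le\lambda$ if $\mu_i\le\lambda_i$ for all $i$ (containment of diagrams). A partition $\mu$ is a $k$-deletion of $\lambda$ if $\mu\le\lambda$ and $|\mu|=|\lambda|-k$. The set of $k$-deletions is a set, without multiplicities. *)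

(* Defs.v *)
From mathcomp Require Import all_boot.

Set Implicit Arguments.
Unset Strict Implicit.
Unset Printing Implicit Defensive.

(* [geq] makes [sorted] mean "nonincreasing". *)
Definition is_partition (s : seq nat) : bool := sorted geq s && (0 \notin s).

Definition is_partition_of (n : nat) (s : seq nat) : bool :=
  is_partition s && (sumn s == n).

(* The default value 0 of [nth] is the convention that parts beyond the length
   vanish. *)
Definition contained (mu la : seq nat) : Prop :=
  forall i : nat, nth 0 mu i <= nth 0 la i.

(* The size condition |nu| = |la| - k is written additively because subtraction
   on nat is truncated. *)
Definition is_deletion (k : nat) (la nu : seq nat) : Prop :=
  [/\ is_partition nu, contained nu la & sumn nu + k = sumn la].

(* In a nonincreasing sequence zeros can only be trailing, so filtering them out
   drops exactly the trailing zeros; this matters for k = 1 only. *)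
Definition part_mu (k : nat) : seq nat :=
  [seq p <- nseq k k.+1 ++ [:: k.-1] | p != 0].

Definition part_lambda (k : nat) : seq nat :=
  nseq k.-1 k.+1 ++ [:: k; k].

(* Main.v *)
Require Import Defs.
From mathcomp Require Import all_boot.
From mathcomp Require Import zify.

(** Both diagrams arise from the (k+1) x (k+1) square by removing two cells:
    the last two cells of the bottom row for [part_mu k], the bottom two cells
    of the last column for [part_lambda k].  So, for a partition [nu] inside
    the square, [nu] lies in [part_mu k] iff its bottom row has at most k-1
    cells, and in [part_lambda k] iff its row of index k-1 has at most k cells.
    A k-deletion has only k(k+1)-1 cells, hence contains neither the rectangle
    with k rows of k+1 cells nor the one with k+1 rows of k cells
    ([nth_mulS_leq_sumn]); it therefore satisfies both conditions as soon as it
    lies in the square. *)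

Lemma geq_trans : transitive geq.
Proof. by move=> y x z /= le_yx le_zy; exact: leq_trans le_zy le_yx. Qed.

Lemma nonincreasing_nth {s : seq nat} {i j : nat} :
  sorted geq s -> i <= j -> nth 0 s j <= nth 0 s i.
Proof.
move=> ss le_ij; case: (ltnP j (size s)) => [lt_j | le_j]; last first.
  by rewrite (nth_default 0 le_j).
have geq_refl : reflexive geq by move=> x /=.
apply: (sorted_leq_nth geq_trans geq_refl 0 ss) => //.
by rewrite inE; exact: leq_ltn_trans lt_j.
Qed.

(** The first i+1 rows all reach the length of row i, so the diagram contains
    a rectangle of that width and height i+1. *)
Lemma nth_mulS_leq_sumn {s : seq nat} (i : nat) :
  sorted geq s -> i.+1 * nth 0 s i <= sumn s.
Proof.
elim: s i => [|x s IHs] [|i] ss; rewrite ?nth_nil ?muln0 //= ?mul1n ?leq_addr //.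
rewrite mulSn leq_add //; first exact: (nonincreasing_nth ss (leq0n i.+1)).
exact: IHs (path_sorted ss).
Qed.

Lemma nth_part_mu (k i : nat) :
  nth 0 (part_mu k) i =
    if i < k then k.+1 else if i == k then k.-1 else 0.
Proof.
rewrite /part_mu filter_cat (all_filterP _); last first.
  by apply/allP => x /nseqP [->].
rewrite nth_cat size_nseq nth_nseq; case: (ltnP i k) => // le_ki.
(* A vanishing last part is filtered out, and the default value restores it. *)
rewrite /=; case: (eqVneq k.-1 0) => [-> | _] /=.
  by rewrite nth_nil if_same.
by case: (eqVneq i k) => [-> | ne_ik];
  rewrite ?subnn // nth_default //=; lia.
Qed.

Lemma nth_part_lambda (k i : nat) (hk : 1 <= k) :
  nth 0 (part_lambda k) i =
    if i < k.-1 then k.+1 else if i <= k then k else 0.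
Proof.
rewrite /part_lambda nth_cat size_nseq nth_nseq; case: (ltnP i k.-1) => // le_i.
case: (leqP i k) => le_ik; last by rewrite nth_default //=; lia.
have [-> | ->] : i - k.-1 = 0 \/ i - k.-1 = 1 by lia.
all: by [].
Qed.

Lemma sorted_geq_nseq_cat (n x : nat) (s : seq nat) :
  sorted geq s -> all (geq x) s -> sorted geq (nseq n x ++ s).
Proof.
move=> ss les; elim: n => [|n IHn] //=.
rewrite (path_sortedE geq_trans) IHn all_cat les andbT andbT.
by apply/allP => y /nseqP [-> _] /=.
Qed.

Lemma part_mu_partition {k : nat} (hk : 1 <= k) :
  is_partition_of (k ^ 2 + 2 * k - 1) (part_mu k).
Proof.
rewrite /is_partition_of /is_partition mem_filter eqxx /= andbT.
apply/andP; split.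
  apply: (sorted_filter geq_trans); apply: sorted_geq_nseq_cat => //=.
  by rewrite andbT; lia.
have sumn_nonzero (s : seq nat) : sumn [seq p <- s | p != 0] = sumn s.
  by elim: s => [|[|x] s IHs] //=; rewrite IHs.
by rewrite sumn_nonzero sumn_cat sumn_nseq /=; apply/eqP; nia.
Qed.

Lemma part_lambda_partition {k : nat} (hk : 1 <= k) :
  is_partition_of (k ^ 2 + 2 * k - 1) (part_lambda k).
Proof.
rewrite /is_partition_of /is_partition; apply/andP; split; [apply/andP; split|].
- by apply: sorted_geq_nseq_cat; rewrite /= ?andbT ?leqnSn ?leqnn.
- rewrite mem_cat !inE mem_nseq; lia.
- by rewrite sumn_cat sumn_nseq /=; apply/eqP; nia.
Qed.

(** If row k-1 had k+1 cells, then the k rows of [part_mu k] above the bottom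
    one would all be full in [nu], which is one cell too many. *)
Lemma contained_mu_lambda {k : nat} {nu : seq nat} (hk : 1 <= k) :
  sorted geq nu -> sumn nu < k * k.+1 ->
  contained nu (part_mu k) -> contained nu (part_lambda k).
Proof.
move=> snu small le_nu.
have row_le : nth 0 nu k.-1 <= k.
  have rect := nth_mulS_leq_sumn k.-1 snu.
  rewrite prednK // in rect; nia.
move=> i; rewrite nth_part_lambda //.
have := le_nu i; rewrite nth_part_mu.
case: (ltnP i k.-1) => [lt_i | le_i]; first by do 2?case: ifP; lia.
have := leq_trans (nonincreasing_nth snu le_i) row_le.
by do 3?case: ifP; lia.
Qed.

(** If the bottom row had k cells, then all k+1 rows would have at least k,
    which is again one cell too many. *)
Lemma contained_lambda_mu {k : nat} {nu : seq nat} (hk : 1 <= k) :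
  sorted geq nu -> sumn nu < k * k.+1 ->
  contained nu (part_lambda k) -> contained nu (part_mu k).
Proof.
move=> snu small le_nu.
have row_le : nth 0 nu k <= k.-1.
  have rect := nth_mulS_leq_sumn k snu; nia.
move=> i; rewrite nth_part_mu.
have := le_nu i; rewrite nth_part_lambda //.
case: (eqVneq i k) => [-> | ne_ik]; first by rewrite ltnn.
by do 3?case: ifP; lia.
Qed.

Theorem mainTheorem2 (k : nat) (hk : 1 <= k) :
  [/\ is_partition_of (k ^ 2 + 2 * k - 1) (part_mu k),
      is_partition_of (k ^ 2 + 2 * k - 1) (part_lambda k),
      part_mu k <> part_lambda k
    & forall nu : seq nat,
        is_deletion k (part_mu k) nu <-> is_deletion k (part_lambda k) nu].
Proof.
have mu_part := part_mu_partition hk.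
have la_part := part_lambda_partition hk.
split=> //.
  (* The two diagrams differ in the bottom row. *)
  move=> /(congr1 (fun s => nth 0 s k)); rewrite nth_part_mu nth_part_lambda //.
  rewrite ltnn eqxx leqnn; case: ifP; lia.
have /andP [_ /eqP sum_mu] := mu_part.
have /andP [_ /eqP sum_la] := la_part.
move=> nu; rewrite /is_deletion sum_mu sum_la.
have small : sumn nu + k = k ^ 2 + 2 * k - 1 -> sumn nu < k * k.+1 by nia.
split=> -[nu_part le_nu size_nu]; have /andP [snu _] := nu_part; split=> //.
  exact: contained_mu_lambda hk snu (small size_nu) le_nu.
exact: contained_lambda_mu hk snu (small size_nu) le_nu.
Qed.
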